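(* Let $(\Omega,\mathcal{F},\mu)$ be a standard probability space and let $K$ be a similarity kernel on $\Omega$. Then there exists a measurable map $\psi:([0,1],\mathcal{B},\lambda)\to(\Omega,\mathcal{F})$, where $\mathcal{B}$ is the Borel $\sigma$-algebra and $\lambda$ is Lebesgue measure, such that $\psi_\#\lambda=\mu$. Define the pullback of $K$ along $\psi$ by $\tilde K(u,u'):=K(\psi(u),\psi(u'))$. Then $\tilde K$ is a similarity kernel on $[0,1]$ and $$H_K(\mu)=H_{\tilde K}(\lambda).$$ If in addition $\mu$ is atomless, $\psi$ may be chosen to be a measure-preserving isomorphism, in which case $([0,1],\lambda,\tilde K)$ is isomorphic to $(\Omega,\mu,K)$.
   Context: A standard probability space is a standard Borel space with a Borel probability measure. A similarity kernel on a measurable space $(\Omega,\mathcal{F})$ is a map $K:\Omega\times\Omega\to[0,1]$ that is $\mathcal{F}\otimes\mathcal{F}$-measurable, symmetric, and satisfies $K(\omega,\omega)=1$ for all $\omega$. For a probability measure $\mu$ on $\Omega$, the typicality function is $\tau(\omega):=\int_\Omega K(\omega,\omega')\,d\mu(\omega')$ and the $K$-entropy is $H_K(\mu):=\int_\Omega(-\log\tau(\omega))\,d\mu(\omega)\in[0,\infty]$, with $-\log 0:=+\infty$. An isomorphism between probability spaces with similarity kernels $(\Omega,\mu,K)$ and $(\Omega',\mu',K')$ is a measurable map $\phi:\Omega\to\Omega'$ such that $\phi_\#\mu=\mu'$, $\phi$ is a bijection with measurable inverse modulo null sets, and $K'(\phi(\omega),\phi(\omega'))=K(\omega,\omega')$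 for $(\mu\otimes\mu)$-a.e. $(\omega,\omega')$. A measure-preserving isomorphism is a measurable map satisfying the first two conditions. *)

(* Defs.v *)
(* MathComp-Analysis development over an arbitrary [R : realType]. *)
From HB Require Import structures.
From mathcomp Require Import all_boot all_order all_algebra.
From mathcomp Require Import all_classical all_reals all_analysis.

Set Implicit Arguments.
Unset Strict Implicit.
Unset Printing Implicit Defensive.

Import Order.TTheory GRing.Theory Num.Theory.
Import numFieldNormedType.Exports.

Local Open Scope classical_set_scope.
Local Open Scope ring_scope.

(* [X] with the topology of its metric is a Polish space.  [X] is not assumed
   pointed, so convergence is stated with an explicit limit. *)
Definition complete_separable (R : realType) (X : metricType R) : Prop :=
  (forall F : set_system X, ProperFilter F -> cauchy F ->
     exists x : X, F --> x) /\
  (exists2 S : set X, countable S & dense S).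

(* [f] is an isomorphism of measurable spaces from [T] to the Borel space of
   [X]: transporting the metric of [X] along [f], this says that the
   sigma-algebra of [T] is the Borel sigma-algebra of a Polish topology. *)
Definition standard_borel (R : realType) d (T : measurableType d) : Prop :=
  exists (X : metricType R) (f : T -> X),
    [/\ complete_separable X,
        bijective f &
        forall A : set X, <<s (@open X) >> A <-> measurable (f @^-1` A)].

Record similarity_kernel (R : realType) d (T : measurableType d)
    (K : T -> T -> R) : Prop := SimilarityKernel {
  sim_range : forall w w', 0 <= K w w' <= 1 ;
  sim_measurable : measurable_fun [set: T * T] (fun p => K p.1 p.2) ;
  sim_sym : forall w w', K w w' = K w' w ;
  sim_refl : forall w, K w w = 1
}.

Section Entropy.
Context (R : realType) d (T : measurableType d).
Variables (mu : probability T R) (K : T -> T -> R).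
Local Open Scope ereal_scope.

Definition typicality (w : T) : \bar R := \int[mu]_w' (K w w')%:E.

(* [lne 0 = -oo], so the integrand is [+oo] where the typicality vanishes. *)
Definition K_entropy : \bar R := \int[mu]_w (- lne (typicality w)).

End Entropy.

Definition pullback_kernel (R : realType) (T T' : Type) (psi : T -> T')
  (K : T' -> T' -> R) : T -> T -> R := fun u u' => K (psi u) (psi u').

Section Isomorphisms.
Context (R : realType) d d' (T : measurableType d) (T' : measurableType d').
Variables (mu : probability T R) (mu' : probability T' R).
Local Open Scope ereal_scope.

(* A measure is only meaningful on measurable sets, hence the restriction. *)
Definition measure_preserving (phi : T -> T') : Prop :=
  measurable_fun [set: T] phi /\
  forall A : set T', measurable A -> pushforward mu phi A = mu' A.

Definition bijective_mod_null (phi : T -> T') : Prop :=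
  exists (D : set T) (D' : set T') (g : T' -> T),
    [/\ measurable D /\ mu (~` D) = 0,
        measurable D' /\ mu' (~` D') = 0,
        set_bij D D' phi,
        {in D, cancel phi g} &
        measurable_fun D' g].

Definition measure_preserving_isomorphism (phi : T -> T') : Prop :=
  measure_preserving phi /\ bijective_mod_null phi.

Definition kernel_isomorphism (K : T -> T -> R) (K' : T' -> T' -> R)
    (phi : T -> T') : Prop :=
  measure_preserving_isomorphism phi /\
  {ae (mu \x mu), forall p : T * T, K' (phi p.1) (phi p.2) = K p.1 p.2}.

Definition isomorphic (K : T -> T -> R) (K' : T' -> T' -> R) : Prop :=
  exists phi : T -> T', kernel_isomorphism K K' phi.

End Isomorphisms.

Definition atomless (R : realType) d (T : measurableType d)
    (mu : probability T R) : Prop :=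
  forall A : set T, measurable A -> (0 < mu A)%E ->
    exists B : set T,
      [/\ measurable B, B `<=` A, (0 < mu B)%E & (mu B < mu A)%E].

(* The measurable sets of [unit_interval R] are the traces on [0, 1] of the
   Borel sets of [R], i.e. the Borel sets of [0, 1]. *)
Definition unit_interval (R : realType) : Type := set_type `[0 : R, 1 : R].

Section UnitInterval.
Variable R : realType.

Let mem01 : (0 : R) \in (`[0, 1]%classic : set R).
Proof. by rewrite inE /= in_itv /= lexx ler01. Qed.

HB.instance Definition _ := Choice.copy (unit_interval R)
  (set_type `[0 : R, 1 : R]).
HB.instance Definition _ :=
  isPointed.Build (unit_interval R) (SigSub mem01 : set_type `[0 : R, 1 : R]).

Definition unit_val : unit_interval R -> R :=
  @set_val R `[0, 1]%classic.

HB.instance Definition _ := Measurable.copy (unit_interval R)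
  (g_sigma_algebra_preimageType (unit_val : unit_interval R -> measurableTypeR R)).

Local Open Scope ereal_scope.

Definition lebesgue01 (A : set (unit_interval R)) : \bar R :=
  lebesgue_measure (unit_val @` A).

Let image_unit_val (B : set R) :
  unit_val @` (unit_val @^-1` B) = `[0%R, 1%R] `&` B.
Proof.
apply/seteqP; split=> [_ [u Bu <-]|x [x01 Bx]].
  by split => //; exact: set_valP u.
have x01' : x \in (`[0%R, 1%R]%classic : set R) by rewrite inE.
by exists (SigSub x01' : set_type `[0%R : R, 1%R : R]).
Qed.

Let measurable_image_unit_val (A : set (unit_interval R)) :
  measurable A -> measurable (unit_val @` A : set (measurableTypeR R)).
Proof.
by move=> [B mB <-]; rewrite setTI image_unit_val; exact: measurableI.
Qed.

Let lebesgue01_0 : lebesgue01 set0 = 0.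
Proof. by rewrite /lebesgue01 image_set0 measure0. Qed.

Let lebesgue01_ge0 A : 0 <= lebesgue01 A.
Proof. exact: measure_ge0. Qed.

Let lebesgue01_sigma_additive : semi_sigma_additive lebesgue01.
Proof.
move=> F mF tF mUF; rewrite /lebesgue01 image_bigcup.
apply: measure_semi_sigma_additive.
- by move=> n; exact: measurable_image_unit_val.
- apply/trivIsetP => i j _ _ ij; rewrite -subset0 => x [[u Fu <-] [v Fv uv]].
  have vu : v = u by exact: val_inj.
  move/trivIsetP: tF => /(_ _ _ Logic.I Logic.I ij) Fij0.
  have : (F i `&` F j) u by split; [exact: Fu|rewrite -vu].
  by rewrite Fij0.
- by rewrite -image_bigcup; exact: measurable_image_unit_val.
Qed.

HB.instance Definition _ := isMeasure.Build _ _ _ lebesgue01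
  lebesgue01_0 lebesgue01_ge0 lebesgue01_sigma_additive.

Let lebesgue01_setT : lebesgue01 setT = 1.
Proof.
rewrite /lebesgue01 -(preimage_setT unit_val) image_unit_val setIT.
by rewrite lebesgue_measure_itv/= lte_fin ltr01 oppr0 adde0.
Qed.

HB.instance Definition _ :=
  Measure_isProbability.Build _ _ _ lebesgue01 lebesgue01_setT.

End UnitInterval.

(* Main.v *)
Require Import Defs.
From HB Require Import structures.
From mathcomp Require Import all_boot all_order all_algebra.
From mathcomp Require Import all_classical all_reals all_analysis.
From mathcomp Require Import measurable_realfun lra.

Set Implicit Arguments.
Unset Strict Implicit.
Unset Printing Implicit Defensive.

Import Order.TTheory GRing.Theory Num.Theory.
Import numFieldNormedType.Exports.

Local Open Scope classical_set_scope.
Local Open Scope ring_scope.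

(** If [psi] pushes Lebesgue measure forward to [mu], then by the change of
variables formula the typicality of the pulled back kernel at [u] is the
typicality of [K] at [psi u], and a second change of variables identifies the
two entropies ([K_entropy_pullback]).  The work is to parametrize a standard Borel
probability space by [0, 1], injectively up to null sets when there are no
atoms ([standard_borel_parametrization]).

The first step is to put the space inside the real line.  Let a Polish space
be given with a countable family of open balls that contains arbitrarily small
balls around each point, and code a point by the sequence of bits telling in
which balls it lies.  A sequence of bits is the code of a point exactly when
the set of balls that it selects is a Cauchy round filter
([ball_code_point_code], [point_codeP]): it is closed upwards and directed for
the relation of lying well inside, and contains arbitrarily small balls.
Indeed the centers of selected balls of radius tending to zero then converge,
by completeness, to a point whose code is the given sequence.  These three
conditions are countable combinations of conditions on single bits, so the
codes form a Borel set, with no appeal to analytic sets or to the theorem on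
injective Borel images.  Reading bit sequences as ternary expansions with
digits 0 and 2 turns them into real numbers; this gives a measurable injection
[h] into the reals with Borel image [E] and a measurable left inverse [g]
([standard_borel_real_coding]).

The second step is the inverse transform method.  If [F] is the distribution
function of [h] and [q] the quantile function, then [q u <= t] is equivalent
to [u <= F t] ([quantile_le]), hence [q] pushes Lebesgue measure forward to
the law of [h] ([pushforward_quantile]), and [psi := g \o q] pushes it forward
to [mu].  If [mu] is atomless then, [h] being injective, the law of [h] charges
no point; so [F (q u) = u] ([cdf_quantile]), and [F \o h] inverts [psi] up to
null sets. *)

(** * Ternary coding of bit sequences *)

Section Ternary.
Variable R : realType.
Implicit Types (c : nat -> bool) (t : R) (n : nat).

Fixpoint ternary_sum c n : R :=
  if n is n'.+1 then (2 * (c 0)%:R + ternary_sum (c \o S) n') / 3 else 0.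

(** The ternary expansion with digits [2 * c 0], [2 * c 1], and so on: an
injection of the Cantor space into the reals. *)
Definition ternary_code c : R := limn (ternary_sum c).

Lemma ternary_sum_itv c n : 0 <= ternary_sum c n <= 1.
Proof.
elim: n c => [|n IH] c /=; first by rewrite lexx ler01.
by have := IH (c \o S); case: (c 0) => /=; lra.
Qed.

(** The recursion in [ternary_sum] shifts the sequence, so the tail of the sum is
handled by the induction hypothesis applied to the shifted sequence. *)
Lemma ternary_sum_nondecreasing c : nondecreasing_seq (ternary_sum c).
Proof.
apply/nondecreasing_seqP => n; elim: n c => [|n IH] c.
  by have /andP[] := ternary_sum_itv c 1.
by have /= := IH (c \o S); lra.
Qed.

Lemma is_cvg_ternary_sum c : cvgn (ternary_sum c).
Proof.
apply: nondecreasing_is_cvgn; first exact: ternary_sum_nondecreasing.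
by exists 1 => _ [n _ <-]; case/andP: (ternary_sum_itv c n).
Qed.

Lemma ternary_code_itv c : 0 <= ternary_code c <= 1.
Proof.
apply/andP; split.
  apply: limr_ge; first exact: is_cvg_ternary_sum.
  by apply: nearW => n; case/andP: (ternary_sum_itv c n).
apply: limr_le; first exact: is_cvg_ternary_sum.
by apply: nearW => n; case/andP: (ternary_sum_itv c n).
Qed.

Lemma ternary_codeS c :
  ternary_code c = (2 * (c 0)%:R + ternary_code (c \o S)) / 3.
Proof.
apply/cvg_lim => //; rewrite -(cvg_shiftS (ternary_sum c)) /=.
apply: cvgMr_tmp; apply: cvgD; first exact: cvg_cst.
exact: is_cvg_ternary_sum.
Qed.

(** On the Cantor set, the expanding map that erases the first digit. *)
Definition ternary_shift t : R := 3 * t - 2 * (2^-1 <= t)%R%:R.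

Definition ternary_digit t n : bool := 2^-1 <= iter n ternary_shift t.

(** The codes are at most [1/3] or at least [2/3] according to their first bit,
and the threshold [1/2] separates the two cases. *)
Lemma ternary_digit0 c : (2^-1 <= ternary_code c) = c 0.
Proof.
rewrite ternary_codeS; have := ternary_code_itv (c \o S).
by case: (c 0) => /= h; [apply/idP|apply/negbTE]; rewrite -?ltNge; lra.
Qed.

Lemma ternary_shift_code c :
  ternary_shift (ternary_code c) = ternary_code (c \o S).
Proof. by rewrite /ternary_shift ternary_digit0 ternary_codeS; lra. Qed.

Lemma ternary_codeK c : ternary_digit (ternary_code c) = c.
Proof.
apply/funext => n; rewrite /ternary_digit.
have -> : iter n ternary_shift (ternary_code c) = ternary_code (c \o addn n).
  elim: n => [//|n IH]; rewrite iterS IH ternary_shift_code.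
  by congr ternary_code; apply/funext => k /=; rewrite addnS.
by rewrite ternary_digit0 /= addn0.
Qed.

Lemma measurable_ternary_digit n : measurable [set t | ternary_digit t n].
Proof.
have mshift : measurable_fun setT ternary_shift.
  rewrite /ternary_shift; apply: measurable_funB; first exact: measurable_funM.
  apply: measurable_funM => //.
  rewrite (_ : (fun t => (_)%:R) = \1_[set t : R | (2^-1 : R) <= t]); last first.
    by apply/funext => t; rewrite indicE mem_setE.
  by apply: measurable_indic; rewrite -[X in measurable X]set_itvcy;
    exact: measurable_itv.
have miter : measurable_fun setT (iter n ternary_shift).
  elim: n => [|n IH]; first exact: measurable_id.
  by apply: (measurableT_comp mshift IH).
rewrite (_ : mkset _ = iter n ternary_shift @^-1` `[2^-1, +oo[); last first.
  by apply/seteqP; split => t /=; rewrite in_itv /= andbT.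
by rewrite -[X in measurable X]setTI; exact: miter.
Qed.

Lemma measurable_ternary_code d (T : measurableType d) (c : T -> nat -> bool) :
  (forall n, measurable [set w | c w n]) ->
  measurable_fun setT (ternary_code \o c).
Proof.
move=> mc; apply: (measurable_fun_cvg (h := fun n w => ternary_sum (c w) n)).
  move=> n; elim: n c mc => [|n IH] c mc /=; first exact: measurable_cst.
  apply: measurable_funM => //; apply: measurable_funD; last first.
    by apply: (IH (fun w => c w \o S)) => k; exact: mc.
  apply: measurable_funM => //.
  rewrite (_ : (fun w => _) = \1_[set w | c w 0]).
    exact: measurable_indic.
  by apply/funext => w; rewrite indicE mem_setE.
by move=> w _; exact: is_cvg_ternary_sum.
Qed.

End Ternary.

(** * Coding the points of a Polish space by balls *)

Section BallCodes.
Variables (R : realType) (X : metricType R).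
Variables (ctr : nat -> X) (rad : nat -> R).
Hypothesis rad_gt0 : forall n, 0 < rad n.
Hypothesis rad_small : forall (x : X) (e : R), 0 < e ->
  exists n, rad n < e /\ mdist (ctr n) x < rad n.
Implicit Types (c : nat -> bool) (x y : X).

Definition ball_code x n : bool := mdist (ctr n) x < rad n.

(** The factor 2 keeps a margin: the closed ball of index [l] is contained in
the open ball of index [n] (see [well_inside_dist]). *)
Definition well_inside l n : bool :=
  mdist (ctr n) (ctr l) + 2 * rad l <= rad n.

(** The sequences of bits that select a Cauchy round filter of balls. *)
Definition point_code c : Prop :=
  [/\ forall l n, well_inside l n -> c l -> c n,
      forall n m, c n -> c m ->
        exists l, [/\ well_inside l n, well_inside l m & c l] &
      forall k, exists n, rad n < k.+1%:R^-1 /\ c n].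

Lemma well_inside_dist l n x :
  well_inside l n -> mdist (ctr l) x <= rad l -> mdist (ctr n) x < rad n.
Proof.
rewrite /well_inside => ln lx.
have := metric_triangle (ctr n) (ctr l) x; have := rad_gt0 l; lra.
Qed.

Lemma ball_code_inj : injective ball_code.
Proof.
move=> x y xy; apply/eqP; rewrite -[_ == _]negbK -mdist_gt0; apply/negP => dxy.
have [|n [nd nx]] := rad_small x (e := mdist x y / 2); first by lra.
have : ball_code x n by [].
rewrite xy /ball_code => ny.
have := metric_triangle x (ctr n) y; rewrite (metric_sym x (ctr n)); lra.
Qed.

(** For directedness: if [x] lies in two balls, any ball containing [x] whose radius
is less than a third of the margin of [x] in each of them lies well inside both. *)
Lemma ball_code_point_code x : point_code (ball_code x).
Proof.
split=> [l n ln /ltW|n m|k].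
- exact: well_inside_dist.
- rewrite /ball_code => nx mx.
  pose e := Num.min ((rad n - mdist (ctr n) x) / 3)
                    ((rad m - mdist (ctr m) x) / 3).
  have e0 : 0 < e by rewrite lt_min; lra.
  have [l [le lx]] := rad_small x e0.
  move: le; rewrite lt_min => /andP[len lem].
  exists l; split=> //; rewrite /well_inside.
    have := metric_triangle (ctr n) x (ctr l); rewrite (metric_sym x); lra.
  have := metric_triangle (ctr m) x (ctr l); rewrite (metric_sym x); lra.
- have [|n [nk nx]] := rad_small x (e := k.+1%:R^-1).
    by rewrite invr_gt0 ltr0n.
  by exists n.
Qed.

(** The center of a selected ball well inside both witnesses that they meet. *)
Lemma point_code_overlap c n m : point_code c -> c n -> c m ->
  mdist (ctr n) (ctr m) < rad n + rad m.
Proof.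
move=> [_ cr _] cn cm; have [l [ln lm _]] := cr _ _ cn cm.
move: ln lm; rewrite /well_inside => ln lm.
have := metric_triangle (ctr n) (ctr l) (ctr m).
by rewrite (metric_sym (ctr l)); have := rad_gt0 l; lra.
Qed.

Hypothesis completeX : forall F : set_system X, ProperFilter F -> cauchy F ->
  exists x : X, F --> x.

(** Selected balls meet pairwise, so the centers of smaller and smaller ones form
a Cauchy sequence, whose limit lies in every closed selected ball.  Roundness
improves this to the open balls; conversely a ball that contains the limit
also has a small selected ball well inside it, hence is selected. *)
Lemma point_codeP c : point_code c -> exists x, ball_code x = c.
Proof.
move=> cP; have [cup cround csmall] := cP.
have /choice[u uP] := csmall.
have u_near (e : R) : 0 < e -> \forall k \near \oo, rad (u k) < e.
  move=> e0; near=> k; have [uk _] := uP k; apply: (lt_trans uk).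
  by near: k; exact: (near_infty_natSinv_lt (PosNum e0)).
have [x ux] : exists x, ctr (u k) @[k --> \oo] --> x.
  apply: completeX; apply: cauchy_exP => e e0.
  have e2 : 0 < e / 2 by lra.
  have [k0 _ k0P] := u_near _ e2.
  exists (ctr (u k0)); exists k0 => // k /= k0k.
  rewrite ballEmdist /=.
  have := point_code_overlap cP (uP k0).2 (uP k).2.
  have := k0P k k0k; have := k0P k0 (leqnn _) => /=; lra.
have dist_lim (e : R) : 0 < e ->
    exists k, rad (u k) < e /\ mdist (ctr (u k)) x < e.
  move=> e0.
  have [k [ke kx]] := filter_ex (filterI (u_near _ e0) (cvg_ball ux e0)).
  by exists k; split => //; move: kx; rewrite ballEmdist /= metric_sym.
have xle l : c l -> mdist (ctr l) x <= rad l.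
  move=> cl; apply/ler_addgt0Pl => e e0.
  have e2 : 0 < e / 2 by lra.
  have [k [ke kx]] := dist_lim _ e2.
  have := point_code_overlap cP cl (uP k).2.
  have := metric_triangle (ctr l) (ctr (u k)) x; lra.
exists x; apply/funext => n; apply/idP/idP => [xn|cn].
  (* A third of the margin of [x] in the ball: one for the distance from [x] to
     the new center, two for the doubled radius. *)
  have e0 : 0 < (rad n - mdist (ctr n) x) / 3 by move: xn; rewrite /ball_code; lra.
  have [k [ke kx]] := dist_lim _ e0.
  apply: (cup (u k)); last exact: (uP k).2.
  rewrite /well_inside.
  have := metric_triangle (ctr n) x (ctr (u k)); rewrite (metric_sym x); lra.
by have [l [ln _ cl]] := cround _ _ cn cn; exact: well_inside_dist ln (xle _ cl).
Unshelve. all: by end_near. Qed.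

End BallCodes.

Lemma separable_balls (R : realType) (X : metricType R) (x0 : X) (S : set X) :
  countable S -> dense S -> exists (ctr : nat -> X) (rad : nat -> R),
    (forall n, 0 < rad n) /\
    (forall (x : X) (e : R), 0 < e ->
       exists n, rad n < e /\ mdist (ctr n) x < rad n).
Proof.
move=> cS dS.
have [s Ss] : exists s : nat -> X, S `<=` range s.
  have /countable_injP[f f_inj] := cS.
  have /choice[s sP] : forall n, exists x, forall y, S y -> f y = n -> x = y.
    move=> n; have [[y Sy <-]|no] := pselect (exists2 y, S y & f y = n).
      by exists y => z Sz /esym fzy; apply: f_inj; rewrite ?inE.
    by exists x0 => y Sy fy; case: no; exists y.
  by exists s => x Sx; exists (f x) => //; exact: sP.
(* All balls around the points [s i] with radius [1 / (m + 1)]; the value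
   [(0, 0)] outside the image of [pickle] only repeats one of them. *)
pose e n : nat * nat := odflt (0, 0)%N (unpickle n).
exists (fun n => s (e n).1), (fun n => (e n).2.+1%:R^-1); split.
  by move=> n; rewrite invr_gt0 ltr0n.
move=> x r r0.
have [m mr] := filter_ex (near_infty_natSinv_lt (PosNum r0)).
have m0 : 0 < m.+1%:R^-1 :> R by rewrite invr_gt0 ltr0n.
have [||y [xy Sy]] := dS (ball x m.+1%:R^-1)°.
- exists x; exact: nbhsx_ballx.
- exact: open_interior.
have [i _ iy] := Ss _ Sy.
exists (pickle (i, m)); rewrite /e pickleK /=; split => //.
have := interior_subset xy; rewrite ballEmdist /= iy.
by rewrite metric_sym.
Qed.

(** * Standard Borel spaces as Borel sets of the real line *)

Lemma measurable_point_code (R : realType) (X : metricType R)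
    (ctr : nat -> X) (rad : nat -> R) d (T : measurableType d)
    (c : T -> nat -> bool) :
  (forall n, measurable [set w | c w n]) ->
  measurable [set w | point_code ctr rad (c w)].
Proof.
move=> mc.
pose Up := \bigcap_l \bigcap_n
  [set w | well_inside ctr rad l n -> c w l -> c w n].
pose Round := \bigcap_n \bigcap_m (~` ([set w | c w n] `&` [set w | c w m]) `|`
  \bigcup_(l in [set l | well_inside ctr rad l n && well_inside ctr rad l m])
    [set w | c w l]).
pose Small := \bigcap_k \bigcup_(n in [set n | rad n < k.+1%:R^-1])
  [set w | c w n].
rewrite (_ : mkset _ = Up `&` Round `&` Small); last first.
  apply/seteqP; split => w /=.
    move=> [up round small]; split; [split|].
    - by move=> l _ n _ /=; exact: up.
    - move=> n _ m _ /=.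
      have [[cn cm]|] := pselect (c w n /\ c w m); last by left.
      have [l [ln lm cl]] := round _ _ cn cm.
      by right; exists l => //=; rewrite ln lm.
    - by move=> k _; have [n [nk cn]] := small k; exists n.
  move=> [[up round] small]; split.
  - by move=> l n; exact: (up l I n I).
  - move=> n m cn cm; have [//|[l /= /andP[ln lm] cl]] := round n I m I.
      by case.
    by exists l.
  - by move=> k; have [n nk cn] := small k I; exists n.
apply: measurableI; [apply: measurableI|].
- apply: bigcapT_measurable => l; apply: bigcapT_measurable => n.
  have [ln|nln] := boolP (well_inside ctr rad l n); last first.
    by rewrite (_ : mkset _ = setT) //; apply/seteqP; split => w.
  rewrite (_ : mkset _ = ~` [set w | c w l] `|` [set w | c w n]).
    by apply: measurableU => //; exact: measurableC.
  apply/seteqP; split => w /=.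
    by move=> h; have [cl|] := boolP (c w l); [right; exact: h|left; apply/negP].
  by move=> [|//] ncl _ /ncl.
- apply: bigcapT_measurable => n; apply: bigcapT_measurable => m.
  apply: measurableU; first by apply: measurableC; exact: measurableI.
  by apply: bigcup_measurable => l _.
- by apply: bigcapT_measurable => k; apply: bigcup_measurable => n _.
Qed.

(** A Borel isomorphism [h] of [T] onto the Borel set [E]; its inverse [g] is
extended to the whole line so that it can be composed with other functions. *)
Definition real_coding (R : realType) d (T : measurableType d)
    (h : T -> R) (E : set R) (g : R -> T) : Prop :=
  [/\ measurable_fun setT h, measurable E, measurable_fun setT g &
      (forall w, E (h w) /\ g (h w) = w) /\ (forall t, E t -> h (g t) = t)].

(** The function [h] is the ternary code of the ball code.  Its image consists of
the numbers [t] that are the code of their own digits, those digits selecting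
a Cauchy round filter.  The inverse [g] is measurable since the preimage by [g] of
a basic ball is, inside [E], the set of numbers that have the corresponding digit,
and every open set is a union of basic balls. *)
Lemma standard_borel_real_coding (R : realType) d (T : measurableType d) :
  standard_borel R T ->
  exists (h : T -> R) (E : set R) (g : R -> T), real_coding h E g.
Proof.
move=> [X [f [[cX [S cS dS]] [f' fK f'K] fP]]].
have [ctr [rad [rad_gt0 rad_small]]] := separable_balls (f point) cS dS.
have f_open (A : set X) : open A -> measurable (f @^-1` A).
  by move=> oA; apply/fP; exact: sub_gen_smallest.
have open_ball n : open [set x | ball_code ctr rad x n].
  rewrite (_ : mkset _ = ball (ctr n) (rad n)); last first.
    by rewrite ballEmdist; apply/seteqP; split => x.
  rewrite openE => x; rewrite ballEmdist /= => xn.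
  rewrite /interior -nbhs_ballE; exists (rad n - mdist (ctr n) x) => /=.
    by rewrite subr_gt0.
  move=> y; rewrite !ballEmdist /=; have := metric_triangle (ctr n) x y; lra.
pose c w := ball_code ctr rad (f w).
have mc n : measurable [set w | c w n] by exact: f_open (open_ball n).
pose E : set R := [set t | point_code ctr rad (ternary_digit t)] `&`
  [set t | ternary_code R (ternary_digit t) = t].
have mE : measurable E.
  apply: measurableI.
    by apply: measurable_point_code => n; exact: measurable_ternary_digit.
  rewrite (_ : mkset _ = (fun t => ternary_code R (ternary_digit t) == t)
    @^-1` [set true]); last first.
    by apply/seteqP; split => t /= /eqP.
  rewrite -[X in measurable X]setTI.
  apply: (@measurable_fun_eqr _ _ _ _ (ternary_code R \o @ternary_digit R) id) => //.
  by apply: measurable_ternary_code => n; exact: measurable_ternary_digit.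
have /choice[g gP] : forall t, exists w, E t -> c w = ternary_digit t.
  move=> t; have [[tP _]|nE] := pselect (E t); last by exists point => /nE.
  have [x xt] := point_codeP rad_gt0 cX tP.
  by exists (f' x) => _; rewrite /c f'K.
pose h w := ternary_code R (c w).
have Eh w : E (h w).
  split; rewrite /= /h ternary_codeK //.
  exact: ball_code_point_code.
have mg : measurable_fun E g.
  suff Em (A : set X) : <<s (@open X) >> A -> measurable (E `&` (f \o g) @^-1` A).
    move=> _ B mB.
    have fB : f @^-1` (f' @^-1` B) = B.
      by apply/seteqP; split => w /=; rewrite fK.
    have := Em (f' @^-1` B); rewrite comp_preimage fB; apply.
    by apply/fP; rewrite fB.
  move: A; apply: smallest_sub.
    split => /=.
    + by rewrite preimage_set0 setI0.
    + move=> A mA; rewrite setTD preimage_setC.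
      rewrite (_ : _ `&` _ = E `\` (E `&` (f \o g) @^-1` A)).
        exact: measurableD.
      by rewrite setDIr setDv set0U.
    + move=> F mF; rewrite preimage_bigcup setI_bigcupr.
      exact: bigcup_measurable.
  move=> A oA /=.
  rewrite (_ : _ `&` _ = \bigcup_(n in [set n | forall x, ball_code ctr rad x n -> A x])
    (E `&` [set t | ternary_digit t n])); last first.
    apply/seteqP; split => t.
      move=> [Et /= At].
      have : nbhs (f (g t)) A by exact: open_nbhs_nbhs.
      rewrite -nbhs_ballE => -[e /= e0 eA].
      have e2 : 0 < e / 2 by lra.
      have [n [ne nx]] := rad_small (f (g t)) (e / 2) e2.
      exists n; last by split=> //=; rewrite -gP.
      move=> x; rewrite /ball_code => xn; apply: eA; rewrite ballEmdist /=.
      have := metric_triangle (f (g t)) (ctr n) x.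
      by rewrite (metric_sym _ (ctr n)); lra.
    by move=> [n /= nA [Et tn]]; split=> //=; apply: nA; rewrite -/(c _) gP.
  apply: bigcup_measurable => n _; apply: measurableI => //.
  exact: measurable_ternary_digit.
exists h, E, (g \_ E); split => //.
- exact: measurable_ternary_code.
- by apply/(measurable_restrictT _ mE).
- split=> [w|t Et]; last by rewrite patchT ?inE // /h gP //; case: Et.
  split=> //; rewrite patchT ?inE //; apply: (can_inj fK); apply: (ball_code_inj rad_small).
  by rewrite -/(c _) gP // /h ternary_codeK.
Qed.

(** * Lebesgue measure on the unit interval *)

Section LebesgueUnitInterval.
Variable R : realType.
Local Open Scope ereal_scope.

Lemma measurable_unit_val :
  measurable_fun setT (@unit_val R : unit_interval R -> measurableTypeR R).
Proof. by move=> _ B mB; exists B. Qed.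

Lemma lebesgue01_preimage (B : set R) :
  lebesgue01 (@unit_val R @^-1` B) = lebesgue_measure (`[0%R, 1%R] `&` B).
Proof.
rewrite /lebesgue01; congr lebesgue_measure.
apply/seteqP; split=> [_ [u Bu <-]|x [x01 Bx]].
  by split => //; exact: set_valP u.
have x01' : x \in (`[0%R, 1%R]%classic : set R) by rewrite inE.
by exists (SigSub x01' : set_type `[0%R : R, 1%R : R]).
Qed.

(** The point 1 is thrown in because [quantile] takes a conventional value there;
for the same reason lower bounds use the open interval of [lebesgue01_oo]. *)
Lemma lebesgue01_ray_le (r : R) : (0 <= r <= 1)%R ->
  lebesgue01 (@unit_val R @^-1` (`]-oo, r] `|` [set 1%R])) <= r%:E.
Proof.
move=> /andP[r0 r1]; rewrite lebesgue01_preimage.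
apply: (@le_trans _ _ (lebesgue_measure (`[0%R, r]%classic `|` [set 1%R]))).
  apply: le_measure; rewrite ?inE.
  - by apply: measurableI => //; exact: measurableU.
  - exact: measurableU.
  - move=> x /=; rewrite !in_itv /= => -[/andP[x0 _] [xr|]]; last by right.
    by left; rewrite x0.
rewrite measureU0 //; last exact: lebesgue_measure_set1.
by rewrite [leLHS]lebesgue_measure_itv /= lte_fin sube0; case: ltP.
Qed.

Lemma lebesgue01_oo (r : R) : (0 <= r <= 1)%R ->
  lebesgue01 (@unit_val R @^-1` `]0%R, r[) = r%:E.
Proof.
move=> /andP[r0 r1]; rewrite lebesgue01_preimage.
rewrite (_ : _ `&` _ = `]0%R, r[%classic); last first.
  apply/seteqP; split => x /=; rewrite !in_itv /=.
    by move=> [_ ->].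
  by move=> /andP[x0 xr]; rewrite x0 xr !ltW // (lt_le_trans xr).
by rewrite lebesgue_measure_itv /= lte_fin sube0; case: ltP => // r0';
  rewrite (@le_anti _ _ r 0%R) // r0 r0'.
Qed.

End LebesgueUnitInterval.

(** * Quantile functions *)

Lemma probability_eq_on_rays (R : realType)
    (P Q : probability (R : measurableType _) R) :
  (forall t, P `]-oo, t]%classic = Q `]-oo, t]%classic) ->
  forall B, measurable B -> P B = Q B.
Proof.
move=> PQ; apply: (@measure_unique _ R (R : measurableType _) (@ocitv R)
  (fun n => `](- n%:R)%R, n%:R%R]%classic) _ _ _ _ P Q).
- by [].
- exact: ocitvI.
- by move=> n; exact: is_ocitv.
- exact: bigcup_itvT.
- move=> _ [[a b] _ <-] /=.
  have [ab|ba] := leP a b; last by rewrite set_itv_ge ?measure0 // bnd_simp -leNgt ltW.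
  have -> : `]a, b]%classic = `]-oo, b] `\` `]-oo, a] :> set R.
    apply/seteqP; split => x /=; rewrite !in_itv /=.
      by move=> /andP[ax ->]; split => //; apply/negP; rewrite -ltNge.
    by move=> [-> /negP]; rewrite -ltNge => ->.
  have sub : `]-oo, a] `<=` (`]-oo, b] : set R) by exact: subitvPr.
  rewrite !measureD // ?ltey_eq ?fin_num_measure //.
  by rewrite (setIidr sub); congr (_ - _)%E; exact: PQ.
- by move=> n; rewrite ltey_eq fin_num_measure.
Qed.

Section Quantile.
Context d (T : measurableType d) (R : realType) (P : probability T R).
Variable X : {RV P >-> R}.
Local Open Scope ereal_scope.
Implicit Types u v t : R.

(** Outside ]0, 1[ the set may be empty or unbounded below, hence the conventional
value. *)
Definition quantile u : R :=
  if (0 < u < 1)%R then inf [set t | u%:E <= cdf X t] else 0%R.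

Lemma cdf_right_limit_ge u t :
  (forall s, (t < s)%R -> u%:E <= cdf X s) -> u%:E <= cdf X t.
Proof.
move=> h; apply: (cvge_ge (F := t^'+)); last exact: cdf_right_continuous.
by near=> s; apply: h; near: s; exact: nbhs_right_gt.
Unshelve. all: by end_near. Qed.

(** The Galois connection between [quantile] and [cdf X]: the infimum is attained
since the distribution function is right-continuous. *)
Lemma quantile_le u t : (0 < u < 1)%R ->
  (quantile u <= t)%R = (u%:E <= cdf X t).
Proof.
move=> u01; rewrite /quantile u01; move: u01 => /andP[u0 u1].
set S := mkset _.
have S0 : S !=set0.
  have [//|/set0P/negP/negPn/eqP S0] := pselect (S !=set0).
  suff : 1 <= u%:E by rewrite lee_fin leNgt u1.
  apply: (cvge_le _ (@cvg_cdfy1 _ _ _ _ X)); apply: nearW => s.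
  by rewrite leNgt; apply/negP => /ltW us; move: S0 => /seteqP[/(_ s us)].
have Slb : has_lbound S.
  have [[s us]|nous] := pselect (exists s, cdf X s < u%:E).
    exists s => r /= ur; rewrite leNgt; apply/negP => rs.
    have := lt_le_trans us (le_trans ur (cdf_nondecreasing X (ltW rs))).
    by rewrite ltxx.
  suff : u%:E <= 0 by rewrite lee_fin leNgt u0.
  apply: (cvge_ge _ (@cvg_cdfNy0 _ _ _ _ X)); apply: nearW => s.
  by rewrite leNgt; apply/negP => su; apply: nous; exists s.
apply/idP/idP => [St|ut]; last exact: ge_inf.
apply: cdf_right_limit_ge => s ts.
have [r Sr rs] := inf_lt S0 (le_lt_trans St ts).
by apply: (le_trans Sr); apply: cdf_nondecreasing; exact: ltW.
Qed.

Lemma quantile_nondecreasing u v : (0 < u)%R -> (v < 1)%R -> (u <= v)%R ->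
  (quantile u <= quantile v)%R.
Proof.
move=> u0 v1 uv; have v01 : (0 < v < 1)%R by rewrite v1 (lt_le_trans u0).
rewrite quantile_le ?u0 ?(le_lt_trans uv) //.
by apply: (@le_trans _ _ v%:E); rewrite ?lee_fin // -quantile_le.
Qed.

Lemma measurable_quantile : measurable_fun setT quantile.
Proof.
apply: measurable_fun_if => //.
  apply: measurable_and.
    by apply: measurable_fun_ltr => //; exact: measurable_id.
  by apply: measurable_fun_ltr => //; exact: measurable_id.
rewrite setTI (_ : _ @^-1` _ = `]0%R, 1%R[%classic); last first.
  by apply/seteqP; split => u /=; rewrite in_itv.
apply: (@eq_measurable_fun _ _ _ _ _ quantile).
  by move=> u; rewrite inE /= in_itv /quantile /= => ->.
apply: (measurability _ (RGenOInfty.measurableE R)) => /= _ [_ [t ->] <-].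
rewrite (_ : _ `&` _ = `]0%R, 1%R[%classic `&` ~` [set u | u%:E <= cdf X t]).
  apply: measurableI => //; apply: measurableC.
  rewrite (_ : mkset _ = `]-oo, fine (cdf X t)]%classic) //.
  apply/seteqP; split => u /=; rewrite in_itv /=;
    by rewrite -lee_fin fineK // fin_num_measure.
apply/seteqP; split => u /=; rewrite !in_itv /= andbT.
  by move=> [u01 tu]; split => //; rewrite -quantile_le // leNgt tu.
by move=> [u01 /negP]; rewrite -quantile_le // -ltNge.
Qed.

Let qv : unit_interval R -> R := quantile \o @unit_val R.

Let mqv : measurable_fun setT qv.
Proof. exact: (measurableT_comp measurable_quantile (@measurable_unit_val R)). Qed.

Let mqv_pre (B : set R) : measurable B -> measurable (qv @^-1` B).
Proof. by move=> mB; rewrite -[X in measurable X]setTI; exact: mqv. Qed.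

Let munit_pre (B : set R) : measurable B -> measurable (@unit_val R @^-1` B).
Proof. by move=> mB; rewrite -[X in measurable X]setTI; exact: measurable_unit_val. Qed.

Let unit_cases (w : unit_interval R) :
  [\/ unit_val w = 0%R, unit_val w = 1%R | (0 < unit_val w < 1)%R].
Proof.
have /= := set_valP w; rewrite in_itv /= -/(unit_val w) => /andP[].
rewrite le_eqVlt => /predU1P[/esym w0 _|w0]; first exact: Or31.
rewrite le_eqVlt => /predU1P[w1|w1]; first exact: Or32.
by apply: Or33; rewrite w0.
Qed.

(** Up to the end points of [0, 1], the left-hand side is the set of [u] such that
[u <= cdf X t], an interval of length [cdf X t]. *)
Lemma pushforward_quantile_ray t :
  lebesgue01 (qv @^-1` `]-oo, t]) = cdf X t.
Proof.
have Ft : cdf X t \is a fin_num by exact: fin_num_measure.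
pose r := fine (cdf X t).
have r01 : (0 <= r <= 1)%R.
  by rewrite -2!lee_fin fineK // cdf_ge0 cdf_le1.
rewrite -(fineK Ft) -/r; apply/eqP; rewrite eq_le; apply/andP; split.
  apply: le_trans (lebesgue01_ray_le r01).
  apply: le_measure; rewrite ?inE; [exact: mqv_pre|
    by apply: munit_pre; exact: measurableU|].
  move=> w /=; rewrite !in_itv /= => wt.
  have [->|->|w01] := unit_cases w; [|by right|].
    by left; case/andP: r01.
  by left; rewrite -lee_fin fineK // -quantile_le.
rewrite -(lebesgue01_oo r01).
apply: le_measure; rewrite ?inE; [exact: munit_pre|exact: mqv_pre|].
move=> w /=; rewrite !in_itv /= => /andP[w0 wr].
rewrite quantile_le ?w0 ?(lt_le_trans wr) //=; last by case/andP: r01.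
by rewrite -(fineK Ft) lee_fin ltW.
Qed.

Lemma pushforward_quantile (B : set R) : measurable B ->
  lebesgue01 (qv @^-1` B) = distribution P X B.
Proof.
move=> mB.
pose qRV : {RV (@lebesgue01 R) >-> R} :=
  HB.pack qv (isMeasurableFun.Build _ _ _ _ qv mqv).
exact: (probability_eq_on_rays (P := distribution (@lebesgue01 R) qRV)
  (Q := distribution P X) pushforward_quantile_ray mB).
Qed.

(** The law does not charge [quantile u], so the left-hand side is the measure of the
[v] such that [quantile v < quantile u]; by monotonicity these are at most [u]. *)
Lemma cdf_quantile u : (forall t, distribution P X [set t] = 0) ->
  (0 < u < 1)%R -> cdf X (quantile u) = u%:E.
Proof.
move=> X0 u01; apply/eqP; rewrite eq_le -quantile_le // lexx andbT.
have -> : cdf X (quantile u) = distribution P X `]-oo, quantile u[.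
  by rewrite /cdf -(@setUitv1 _ _ _ _ true) //= measureU0 //; exact: X0.
rewrite -pushforward_quantile //.
apply: le_trans (lebesgue01_ray_le _); last by case/andP: u01 => /ltW -> /ltW ->.
apply: le_measure; rewrite ?inE; [exact: mqv_pre|
    by apply: munit_pre; exact: measurableU|].
move=> w /=; rewrite !in_itv /= => wu.
have [->|->|/andP[w0 w1]] := unit_cases w; [|by right|].
  by left; case/andP: u01 => /ltW.
left; rewrite leNgt; apply/negP => uw.
have := quantile_nondecreasing _ w1 (ltW uw); rewrite leNgt wu.
by case/andP: u01 => u0 _ /(_ u0).
Qed.

End Quantile.

(** * Entropy of a pulled back kernel *)

Section EntropyPullback.
Context (R : realType) d d' (T : measurableType d) (T' : measurableType d').
Variables (mu : probability T R) (mu' : probability T' R).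
Variable psi : T -> T'.
Hypothesis mp_psi : measure_preserving mu mu' psi.
Local Open Scope ereal_scope.

Lemma measure_preserving_integral (f : T' -> \bar R) :
  measurable_fun setT f -> (forall y, 0 <= f y) ->
  \int[mu]_x f (psi x) = \int[mu']_y f y.
Proof.
move=> mf f0; have [mpsi psiE] := mp_psi.
have := @ge0_integral_pushforward _ _ _ _ R psi mpsi mu setT f measurableT mf
  (fun y _ => f0 y).
rewrite preimage_setT => <-.
pose psiM : {mfun T >-> T'} := HB.pack psi (isMeasurableFun.Build _ _ _ _ psi mpsi).
apply: (eq_measure_integral mu' (m1 := distribution mu psiM)) => A mA _.
exact: psiE.
Qed.

Variable K : T' -> T' -> R.
Hypothesis hK : similarity_kernel K.

Lemma similarity_kernel_pullback : similarity_kernel (pullback_kernel psi K).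
Proof.
case: hK => K01 mK Ksym Kxx; split => [u v||u v|u].
- exact: K01.
- have [mpsi _] := mp_psi.
  apply: (measurableT_comp (f := fun p => K p.1 p.2)
    (g := fun p => (psi p.1, psi p.2))) => //.
  by apply: measurable_fun_pair; exact: measurableT_comp.
- exact: Ksym.
- exact: Kxx.
Qed.

Let mKE : measurable_fun setT (fun p : T' * T' => (K p.1 p.2)%:E).
Proof. by apply/measurable_EFinP; exact: sim_measurable hK. Qed.

Let K_ge0 x y : 0 <= (K x y)%:E.
Proof. by rewrite lee_fin; have /andP[] := sim_range hK x y. Qed.

Lemma measurable_typicality : measurable_fun setT (typicality mu' K).
Proof.
exact: (measurable_fun_fubini_tonelli_F (m2 := mu')
  (fun p => (K p.1 p.2)%:E)).
Qed.

Lemma typicality_itv w : 0 <= typicality mu' K w <= 1.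
Proof.
apply/andP; split; first by apply: integral_ge0.
apply: (@le_trans _ _ (\int[mu']_y (cst 1 y))).
  apply: ge0_le_integral => //.
    exact: (measurable_fun_pair2 w mKE).
  by move=> y _; rewrite lee_fin; have /andP[] := sim_range hK w y.
by rewrite integral_cst // mul1e probability_le1.
Qed.

Lemma typicality_pullback u :
  typicality mu (pullback_kernel psi K) u = typicality mu' K (psi u).
Proof.
apply: (measure_preserving_integral (f := fun y => (K (psi u) y)%:E)) => //.
exact: (measurable_fun_pair2 (psi u) mKE).
Qed.

(** Typicalities are at most 1, so [- lne] of them is nonnegative and the change of
variables formula applies to it, infinite values included. *)
Lemma K_entropy_pullback :
  K_entropy mu' K = K_entropy mu (pullback_kernel psi K).
Proof.
rewrite /K_entropy -measure_preserving_integral.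
- by apply: eq_integral => u _; rewrite typicality_pullback.
(* Since the typicality is finite, [lne] reduces to [ln] off its zero set. *)
- rewrite (_ : (fun w => _) = fun w => if typicality mu' K w <= 0 then +oo
    else (- ln (fine (typicality mu' K w)))%:E); last first.
    apply/funext => w; case: ifPn => [/le0_lneNy -> //|]; rewrite -ltNge => t0.
    have /andP[_ t1] := typicality_itv w.
    rewrite -{1}(@fineK _ (typicality mu' K w)).
      by rewrite lne_EFin ?EFinN // fine_gt0 // t0 (le_lt_trans t1) // ltry.
    by rewrite ge0_fin_numE ?(ltW t0) // (le_lt_trans t1) // ltry.
  apply: measurable_fun_ifT => //.
    apply: (measurable_fun_bool true).
    rewrite (_ : _ @^-1` _ = [set w | typicality mu' K w <= 0]) //.
    by apply: emeasurable_fun_infty_c => //; exact: measurable_typicality.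
  apply/measurable_EFinP; apply: measurable_funN.
  apply: (measurableT_comp (@measurable_ln R)).
  apply: (measurableT_comp (fine_measurable measurableT)).
  exact: measurable_typicality.
- move=> w; have /andP[t0 t1] := typicality_itv w.
  by rewrite oppe_ge0 lne_le0.
Qed.

End EntropyPullback.

(** * Parametrization by the unit interval *)

(** The function is [g \o quantile], for the real coding [(h, E, g)].  When [mu] is
atomless, its inverse is [F \o h], with [F] the distribution function of [h]; the
conull sets on which they are inverse to each other are the [u] in ]0, 1[ whose
quantile is in [E], and the [w] such that [F (h w)] is in ]0, 1[ and has quantile [h w]. *)
Lemma standard_borel_parametrization (R : realType) d (T : measurableType d)
    (mu : probability T R) :
  standard_borel R T ->
  exists psi : unit_interval R -> T,
    measure_preserving (@lebesgue01 R) mu psi /\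
    (atomless mu -> bijective_mod_null (@lebesgue01 R) mu psi).
Proof.
move=> /standard_borel_real_coding[h [E [g [mh mE mg [Eh hg]]]]].
pose hM : {RV mu >-> R} := HB.pack h (isMeasurableFun.Build _ _ _ _ h mh).
pose q := quantile hM.
pose psi (u : unit_interval R) := g (q (unit_val u)).
have mq_unit : measurable_fun setT (q \o @unit_val R).
  exact: (measurableT_comp (measurable_quantile hM) (@measurable_unit_val R)).
have mpsi : measurable_fun setT psi := measurableT_comp mg mq_unit.
have mp : measure_preserving (@lebesgue01 R) mu psi.
  split=> // A mA.
  have mgA : measurable (g @^-1` A) by rewrite -[X in measurable X]setTI; exact: mg.
  have := pushforward_quantile hM mgA => /= qA.
  rewrite /pushforward; transitivity (mu (h @^-1` (g @^-1` A))); first exact: qA.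
  by congr (mu _); apply/seteqP; split => w /=; rewrite (Eh w).2.
exists psi; split => // mu_atomless.
(* The fiber of [h] over [t] has at most one point, so a non-null subset of it is
   the whole fiber: a charged fiber would be an atom. *)
have h_null t : distribution mu hM [set t] = 0%E.
  apply/eqP; apply/negPn/negP => mut.
  have mt : measurable (h @^-1` [set t]).
    by rewrite -[X in measurable X]setTI; exact: (mh measurableT).
  have [|B [mB Bt B0 Blt]] := mu_atomless _ mt.
    by rewrite lt_neqAle eq_sym mut /=.
  have [w Bw] : B !=set0.
    by apply/set0P/eqP => B00; move: B0; rewrite B00 measure0 ltxx.
  move: Blt; rewrite ltNge => /negP; apply; apply: le_measure; rewrite ?inE //.
  move=> v /= hv; have hw : h w = t := Bt _ Bw.
  by rewrite -(Eh v).2 hv -hw (Eh w).2.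
pose F t := fine (cdf hM t).
have F01 t : 0 <= F t <= 1.
  by rewrite -2!lee_fin fineK ?cdf_ge0 ?cdf_le1 // fin_num_measure.
have Fq u : 0 < u < 1 -> F (q u) = u.
  by move=> u01; rewrite /F cdf_quantile.
have mF : measurable_fun setT F.
  by apply: (measurableT_comp (fine_measurable measurableT)); exact: cdf_measurable.
have /choice[r rP] : forall w, exists u : unit_interval R, unit_val u = F (h w).
  move=> w; have x01 : F (h w) \in (`[0, 1]%classic : set R).
    by rewrite inE /= in_itv /= F01.
  by exists (SigSub x01 : set_type `[0%R : R, 1%R : R]).
pose D := @unit_val R @^-1` `]0, 1[ `&` (q \o @unit_val R) @^-1` E.
pose D' := (fun w => (0 < F (h w) < 1) && (q (F (h w)) == h w)) @^-1` [set true].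
have mFh : measurable_fun setT (F \o h) := measurableT_comp mF mh.
have mD1 : measurable (@unit_val R @^-1` `]0, 1[).
  by rewrite -[X in measurable X]setTI; exact: measurable_unit_val.
have mD2 : measurable ((q \o @unit_val R) @^-1` E).
  by rewrite -[X in measurable X]setTI; exact: mq_unit.
have mD : measurable D by exact: measurableI.
have mD' : measurable D'.
  rewrite /D' -[X in measurable X]setTI.
  apply: measurable_and => //.
    apply: measurable_and; apply: measurable_fun_ltr => //; exact: measurable_id.
  apply: measurable_fun_eqr => //.
  exact: (measurableT_comp (measurable_quantile hM) mFh).
have null1 : lebesgue01 (~` (@unit_val R @^-1` `]0, 1[)) = 0%E.
  rewrite (probability_setC (@lebesgue01 R) mD1).
  rewrite [X in (1 - X)%E](_ : _ = 1%E) ?subee //.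
  by apply: (lebesgue01_oo (r := 1 : R)); rewrite ler01 lexx.
have null2 : lebesgue01 (~` ((q \o @unit_val R) @^-1` E)) = 0%E.
  apply: etrans (pushforward_quantile hM (measurableC mE)) _.
  rewrite -(measure0 mu); congr (mu _); apply/seteqP; split => // w nE.
  by apply: nE; case: (Eh w).
have nullD : lebesgue01 (~` D) = 0%E.
  by rewrite /D setCI measureU0 //; exact: measurableC.
have psiD u : D u -> D' (psi u) /\ r (psi u) = u.
  move=> [/= u01 Eu]; rewrite in_itv /= in u01.
  have hpsi : h (psi u) = q (unit_val u) by exact: hg.
  have Fpsi : F (h (psi u)) = unit_val u by rewrite hpsi Fq.
  split; first by rewrite /D' /= Fpsi u01 hpsi eqxx.
  by apply: val_inj; rewrite -[LHS]/(unit_val _) rP Fpsi.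
exists D, D', r; split => //.
- split => //.
  rewrite -(mp.2 (~` D')); last exact: measurableC.
  apply: (@subset_measure0 _ _ _ _ _ (~` D)) => //.
  + rewrite -[X in measurable X]setTI; apply: mpsi => //; exact: measurableC.
  + exact: measurableC.
  + by move=> u nD' Du; apply: nD'; case: (psiD _ Du).
- split.
  + by move=> u /psiD[].
  + by move=> u v; rewrite !inE => /psiD[_ uE] /psiD[_ vE] uv; rewrite -uE uv vE.
  + move=> w /= /andP[F01w /eqP qF]; exists (r w).
      by split; rewrite /= rP ?in_itv //= qF; case: (Eh w).
    by rewrite /psi rP qF (Eh w).2.
- by move=> u; rewrite inE => /psiD[].
- move=> _ _ [B mB <-].
  rewrite setTI (_ : _ @^-1` _ = (F \o h) @^-1` B).
    by apply: measurableI => //; rewrite -[X in measurable X]setTI; exact: mFh.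
  by apply/seteqP; split => w /=; rewrite rP.
Qed.

Theorem theorem2p10 (R : realType) (d : measure_display)
    (Omega : measurableType d) (mu : probability Omega R)
    (K : Omega -> Omega -> R)
    (hOmega : standard_borel R Omega)
    (hK : similarity_kernel K) :
  (exists psi : unit_interval R -> Omega,
     [/\ measure_preserving (@lebesgue01 R) mu psi,
         similarity_kernel (pullback_kernel psi K) &
         K_entropy mu K
         = K_entropy (@lebesgue01 R) (pullback_kernel psi K)]) /\
  (atomless mu ->
   exists psi : unit_interval R -> Omega,
     [/\ measure_preserving_isomorphism (@lebesgue01 R) mu psi,
         similarity_kernel (pullback_kernel psi K),
         K_entropy mu K
         = K_entropy (@lebesgue01 R) (pullback_kernel psi K) &
         isomorphic (@lebesgue01 R) mu (pullback_kernel psi K) K]).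
Proof.
have [psi [mp iso]] := standard_borel_parametrization mu hOmega.
have sK := similarity_kernel_pullback mp hK.
have eK := K_entropy_pullback mp hK.
split=> [|/iso bij]; exists psi; split => //.
by exists psi; split => //; exact: aeW.
Qed.
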